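(* Let $W = C_4 \wr Sym(3)$ be the wreath product whose base group is $C_4 \times C_4 \times C_4$, with generators $\gamma_1, \gamma_2, \gamma_3$ of the three factors, and let $a = (2\,3)$, $b = (1\,2\,3)$ be generators of $Sym(3)$ acting coordinate-wise on the base group. Set $\gamma = \gamma_1\gamma_2\gamma_3$, $H = \langle \gamma \rangle$, $x = \gamma_1^{-1}\gamma_2^{2}\gamma_3^{-1}$, $y = \gamma_1^{-1}\gamma_2^{-1}\gamma_3^{2}$ and $G = \langle x, y, a, b \rangle \le W$. Then $G$ is isomorphic to $G(4,4,3)$, $W$ is the internal direct product of $G$ and $H$, and $$12 = \mu(G \times H) < \mu(G) + \mu(H) = 16.$$ In particular, the equality $\mu(H \times K) = \mu(H) + \mu(K)$ does not hold for all finite groups $H$ and $K$, and there is a counter-example of degree $12$.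
   Context: For a finite group $X$, $\mu(X)$ denotes the minimal faithful permutation degree of $X$: the least non-negative integer $n$ such that $X$ embeds in the symmetric group $Sym(n)$. $C_m$ is the cyclic group of order $m$. The wreath product $C_4 \wr Sym(3)$ is the semidirect product of the base group $C_4 \times C_4 \times C_4$ by $Sym(3)$, where $Sym(3)$ permutes the coordinates: with the convention $g^h = h^{-1}gh$, $\gamma_i^{\sigma} = \gamma_{j}$ where $j$ is the image of $i$ under $\sigma \in Sym(3)$. (So $\gamma_1^b=\gamma_2$, $\gamma_2^b=\gamma_3$, $\gamma_3^b=\gamma_1$; products of permutations are read from left to right.) For positive integers $m, n$ and a divisor $p$ of $m$, let $B = C_m \times \cdots \times C_m$ ($n$ copies) and $A(m,p,n) = \{(\theta_1, \ldots, \theta_n) \in B \mid (\theta_1\theta_2\cdots\theta_n)^{m/p} = 1\}$. The group $G(m,p,n)$ is the semidirect product of $A(m,p,n)$ by $Sym(n)$, with $Sym(n)$ acting on $A(m,p,n)$ by permuting the coordinates. In particular $G(4,4,3) = A(4,4,3) \rtimes Sym(3)$ with $A(4,4,3) = \{(\theta_1,\theta_2,\theta_3) \in C_4^3 \mid \theta_1\theta_2\theta_3 = 1\}$. *)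

(* Defs.v *)
From mathcomp Require Import all_boot all_fingroup all_algebra all_solvable.

Set Implicit Arguments.
Unset Strict Implicit.
Unset Printing Implicit Defensive.

Local Open Scope group_scope.

Definition embeds_in_Sym (gT : finGroupType) (X : {group gT}) (n : nat) : bool :=
  [exists K : {group 'S_n}, X \isog K].

Lemma exists_embeds_in_Sym (gT : finGroupType) (X : {group gT}) :
  exists n, embeds_in_Sym X n.
Proof.
pose n := #|gT|.
have regI (g : gT) : injective (fun i : 'I_n => enum_rank (enum_val i * g)).
  by move=> i j /enum_rank_inj /mulIg /enum_val_inj.
pose r g : 'S_n := perm (@regI g).
have rM : {in X &, {morph r : g h / g * h}}.
  by move=> g h _ _; apply/permP => i; rewrite permM !permE enum_rankK mulgA.
have injr : 'injm (Morphism rM).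
  apply/injmP => g h _ _ /permP /(_ (enum_rank 1)).
  by rewrite /= !permE enum_rankK !mul1g => /enum_rank_inj.
by exists n; apply/existsP; exists (Morphism rM @* X)%G; apply/sub_isog.
Qed.

Definition mu (gT : finGroupType) (X : {group gT}) : nat :=
  ex_minn (exists_embeds_in_Sym X).

(* C_m as the additive group of integers mod m, written multiplicatively; only
   meaningful for m > 0.  'Z_m would be wrong for m = 1. *)
Definition cyc (m : nat) : finGroupType := 'I_m.-1.+1.

Section CoordinateAction.

Variables (gT : finGroupType) (n : nat).

(* The inverse makes this a right action sending the element supported at i
   with value g to the element supported at s i with value g. *)
Definition coord_perm (th : {dffun 'I_n -> gT}) (s : 'S_n) : {dffun 'I_n -> gT} :=
  [ffun i => th (s^-1 i)].

Lemma coord_perm1 : coord_perm^~ 1 =1 id.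
Proof. by move=> th; apply/ffunP => i; rewrite ffunE invg1 perm1. Qed.

Lemma coord_permM th : act_morph coord_perm th.
Proof. by move=> s t; apply/ffunP => i; rewrite !ffunE invMg permM. Qed.

Canonical coord_action := TotalAction coord_perm1 coord_permM.

Lemma coord_is_groupAction :
  is_groupAction [set: {dffun 'I_n -> gT}] coord_action.
Proof.
move=> s _; rewrite inE; apply/andP; split; first by apply/subsetP => th; rewrite inE.
by apply/morphicP => th u _ _; rewrite !actpermE; apply/ffunP => i; rewrite !ffunE.
Qed.

Canonical coord_groupAction := GroupAction coord_is_groupAction.

Definition wreathSym : finGroupType := sdprod_by coord_groupAction.

End CoordinateAction.

Section Gmpn.

Variables m p n : nat.

Definition A_set : {set {dffun 'I_n -> cyc m}} :=
  [set th : {dffun 'I_n -> cyc m} | (\prod_(i < n) th i) ^+ (m %/ p) == 1].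

Lemma prod_cycE (f : 'I_n -> cyc m) : \prod_(i < n) f i = (\sum_(i < n) f i)%R.
Proof. by []. Qed.

Lemma prod_cycM (th u : {dffun 'I_n -> cyc m}) :
  \prod_(i < n) (th * u) i = (\prod_(i < n) th i) * (\prod_(i < n) u i).
Proof.
by rewrite !prod_cycE -[RHS]big_split; apply: eq_bigr => i _; rewrite mulg_ffun.
Qed.

Lemma A_group_set : group_set A_set.
Proof.
apply/group_setP; split=> [|th u].
  by rewrite inE big1 ?expg1n // => i _; rewrite oneg_ffun.
rewrite !inE prod_cycM => /eqP thA /eqP uA.
by rewrite expgMn ?thA ?uA ?mulg1 //; exact: Zp_mulgC.
Qed.

(* As for [G_mpn] below, only meaningful for m > 0 and p a divisor of m. *)
Definition A_mpn := Group A_group_set.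

Lemma coord_acts_A :
  {acts [set: 'S_n], on group A_mpn | coord_groupAction (cyc m) n}.
Proof.
split; last exact: subsetT.
apply/actsP => s _ th; rewrite /= !inE; congr (_ ^+ _ == 1).
rewrite !prod_cycE [RHS](reindex_inj (@perm_inj _ s^-1)) /=.
by apply: eq_bigr => i _; rewrite ffunE.
Qed.

Definition G_mpn : finGroupType := sdprod_by <[coord_acts_A]>%gact.

End Gmpn.

Section WreathElements.

Variables (gT : finGroupType) (n : nat).

(* The element of the base group of gT wr Sym(n) with value g at coordinate i. *)
Definition wr_coord (i : 'I_n) (g : gT) : wreathSym gT n :=
  sdpair1 (coord_groupAction gT n) (dfung1 (gT := fun=> gT) (i := i) g).

Definition wr_perm (s : 'S_n) : wreathSym gT n :=
  sdpair2 (coord_groupAction gT n) s.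

Lemma wr_coordJ (i : 'I_n) (g : gT) (s : 'S_n) :
  wr_coord i g ^ wr_perm s = wr_coord (s i) g.
Proof.
rewrite /wr_coord /wr_perm -sdpair_act ?inE //; congr (sdpair1 _ _).
apply/ffunP => j; rewrite ffunE; have [<-|ne] := eqVneq (s i) j.
  by rewrite permK !dfung1_id.
rewrite !dfung1_dflt //; apply: contraNneq ne => ->.
by rewrite permKV.
Qed.

End WreathElements.

(* Main.v *)
Require Import Defs.
From mathcomp Require Import all_boot all_fingroup all_algebra all_solvable.
From mathcomp Require Import zify.

(** Inside W = C_4 wr Sym(3), let A be the group of base vectors of product 1.
The elements [x], [y] generate A and [a], [b] generate Sym(3), so that G is the
copy A Sym(3) of G(4,4,3) in W ([G_eq], [wr_Gmpn_isog]).

Since 3 is prime to 4, W is the direct product of G and the central subgroup H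
of constant vectors ([dprod_G_H]): a constant vector r has product r^3, and a
vector of product t is the product of a vector of product t * t^3 = 1 by the
constant vector t^-1.

The group W permutes faithfully the 12 points of {1,2,3} x C_4
([embeds_wreathSym]), so both G and G x H, which is isomorphic to W, have
degree at most 12.

For the lower bound, A = C_4 x C_4 is generated by u = (c, c^-1, 1) and
v = u^b = (1, c, c^-1), and its involutions are z1 = u^2, z2 = v^2 and
z3 = z1 z2, which b permutes cyclically.  Let G act faithfully; then z1 moves
some point.  If z2 and z3 move it as well, no involution of A, hence no
nontrivial element of A, fixes that point, and its A-orbit has 16 points
([free_bound]).  Otherwise exactly one involution fixes that point.  The sets
of points fixed by exactly one given involution are disjoint and permuted by b;
the one of z1 is stable under v, and v^2 = z2 moves all of its points, so it
contains a 4-cycle of v.  This gives 3 * 4 = 12 points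
([fixed_moved_bound]).

As mu(C_4) = 4 ([mu_cyclic4]), the sum of the degrees of G and H is 16. *)

Set Implicit Arguments.
Unset Strict Implicit.
Unset Printing Implicit Defensive.

Local Open Scope group_scope.

(** * Minimal faithful permutation degree *)

(** Transport of structure along the enumeration of [T]. *)
Lemma embeds_of_injm (gT : finGroupType) (X : {group gT}) (T : finType)
    (f : {morphism X >-> {perm T}}) :
  'injm f -> embeds_in_Sym X #|T|.
Proof.
move=> injf.
have eI (s : {perm T}) : injective (fun i : 'I_#|T| => enum_rank (s (enum_val i))).
  by move=> i j /enum_rank_inj/perm_inj/enum_val_inj.
pose e s : 'S_#|T| := perm (@eI s).
have eM : {in [set: {perm T}] &, {morph e : s t / s * t}}.
  by move=> s t _ _; apply/permP=> i; rewrite permM !permE /= enum_rankK.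
have einj : injective e.
  move=> s t /permP est; apply/permP=> p; apply: enum_rank_inj.
  by have:= est (enum_rank p); rewrite !permE enum_rankK.
have gM : {in X &, {morph (fun h => e (f h)) : h k / h * k}}.
  by move=> h k Xh Xk; rewrite morphM ?eM ?inE.
apply/existsP; exists (Morphism gM @* X)%G; apply: sub_isog => //.
by apply/injmP=> h k Xh Xk /= /einj; apply: (injmP injf).
Qed.

Lemma embeds_subset (gT : finGroupType) (X Y : {group gT}) (n : nat) :
  Y \subset X -> embeds_in_Sym X n -> embeds_in_Sym Y n.
Proof.
move=> sYX /existsP[K /isogP[f injf _]].
by apply/existsP; exists (f @* Y)%G; apply: sub_isog.
Qed.

Lemma isog_embeds {gT rT : finGroupType} {X : {group gT}} {Y : {group rT}} n :
  X \isog Y -> embeds_in_Sym X n = embeds_in_Sym Y n.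
Proof.
move=> isoXY; apply/existsP/existsP=> -[K isoK]; exists K.
  by apply: isog_trans isoK; rewrite isog_sym.
exact: isog_trans isoK.
Qed.

Lemma mu_min (gT : finGroupType) (X : {group gT}) n :
  embeds_in_Sym X n -> mu X <= n.
Proof. by rewrite /mu; case: ex_minnP => m _; apply. Qed.

Lemma mu_embeds (gT : finGroupType) (X : {group gT}) : embeds_in_Sym X (mu X).
Proof. by rewrite /mu; case: ex_minnP. Qed.

Lemma mu_isog {gT rT : finGroupType} {X : {group gT}} {Y : {group rT}} :
  X \isog Y -> mu X = mu Y.
Proof.
move=> isoXY; apply/eqP; rewrite eqn_leq; apply/andP; split; apply: mu_min.
  by rewrite (isog_embeds _ isoXY) mu_embeds.
by rewrite -(isog_embeds _ isoXY) mu_embeds.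
Qed.

(** Regular action for the upper bound; for the lower bound, 4 divides the order
    n! of Sym(n), which forces n >= 4. *)
Lemma mu_cyclic4 (gT : finGroupType) (X : {group gT}) :
  cyclic X -> #|X| = 4 -> mu X = 4.
Proof.
move=> cycX oX; apply/eqP; rewrite eqn_leq; apply/andP; split.
  apply: mu_min.
  have isoX : X \isog [set: cyc 4].
    rewrite isog_cyclic_card // oX cardsT card_ord eqxx andbT.
    by apply/cyclicP; exists (Zp1 : cyc 4); exact: Zp_cycle.
  rewrite (isog_embeds _ isoX) -[X in embeds_in_Sym _ X](card_ord 4).
  apply: (@embeds_of_injm _ _ _ [morphism of actperm 'R]).
  apply/injmP=> h k _ _ /permP/(_ 1).
  by rewrite /= !actpermE /= !mul1g.
have /existsP[K isoK] := mu_embeds X.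
have: 4 %| (mu X)`! by rewrite -card_Sn -cardsT -oX (card_isog isoK) cardSg ?subsetT.
by case: (mu X) => [|[|[|[|n]]]].
Qed.

(** * Permutation actions of the group (C_4 x C_4) : C_3 *)

(** Every nontrivial subgroup of a cyclic group of order 4 contains its
    involution, so a subgroup missing [u ^+ 2] meets [<[u]>] trivially. *)
Lemma expg4_dvdn {gT : finGroupType} {u : gT} {S : {group gT}} {k : nat} :
  u ^+ 4 = 1 -> u ^+ 2 \notin S -> u ^+ k \in S -> 4 %| k.
Proof.
move=> u4 Su2.
have odd_dvd j : u ^+ 2 ^+ j \in S -> ~~ odd j.
  apply: contraL => odd_j; rewrite -(odd_double_half j) odd_j addnC expgD.
  by rewrite -mul2n expgM -[u ^+ 2 ^+ 2]expgM u4 expg1n mul1g.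
move=> Suk.
have /odd_dvd ek : u ^+ 2 ^+ k \in S by rewrite expgAC groupX.
have: u ^+ 2 ^+ k./2 \in S by rewrite -expgM mul2n even_halfK.
by move/odd_dvd; lia.
Qed.

Lemma order_eq4 (gT : finGroupType) (u : gT) :
  u ^+ 4 = 1 -> u ^+ 2 != 1 -> #[u] = 4.
Proof.
move=> u4 u2; have: #[u] %| 4 by rewrite order_dvdn u4.
have: ~~ (#[u] %| 2) by rewrite order_dvdn.
by have:= order_gt0 u; case: #[u] => [|[|[|[|[|]]]]].
Qed.

Lemma semiregular4 (T : finType) (v : {perm T}) (p : T) :
  v ^+ 4 = 1 -> (v ^+ 2) p != p -> #|orbit 'P <[v]> p| = 4.
Proof.
move=> v4 v2p.
have v2S : v ^+ 2 \notin 'C[p | 'P].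
  by rewrite (sameP astab1P eqP).
have TI : 'C_(<[v]>)[p | 'P] = 1.
  apply/trivgP/subsetP=> _ /setIP[/cycleP[k ->] Svk]; rewrite inE.
  by have /dvdnP[j ->] := expg4_dvdn v4 v2S Svk; rewrite mulnC expgM v4 expg1n.
rewrite card_orbit TI indexg1; apply: (order_eq4 v4).
by apply: contraNneq v2p => ->; rewrite perm1.
Qed.

(** For two distinct involutions [s], [t] of a Klein four-group, these are the
    points whose stabiliser in that group is exactly [<[s]>]. *)
Definition fixed_moved {T : finType} (s t : {perm T}) : {set T} :=
  [set p | (s p == p) && (t p != p)].

Lemma card_fixed_movedJ (T : finType) (b s t : {perm T}) :
  #|fixed_moved (s ^ b) (t ^ b)| = #|fixed_moved s t|.
Proof.
rewrite -[RHS](card_imset _ (@perm_inj _ b)); apply: eq_card => q.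
rewrite -[q](permKV b) mem_imset; last exact: perm_inj.
by rewrite !inE !permJ !(inj_eq perm_inj).
Qed.

(** When [z3 = z1 * z2], the three sets below are those of the points with
    stabiliser [<[z1]>], [<[z2]>], [<[z3]>] in [{1, z1, z2, z3}].
    The cyclic pattern of fixed and moved points makes them disjoint, [b]
    permutes them, and [v] preserves the first one, on which its cycles have
    length 4. *)
Lemma fixed_moved_bound (T : finType) (b v z1 z2 z3 : {perm T}) (p : T) :
    z1 ^ b = z2 -> z2 ^ b = z3 -> z3 ^ b = z1 ->
    commute v z1 -> v ^+ 4 = 1 -> v ^+ 2 = z2 ->
  z1 p == p -> z2 p != p -> 12 <= #|T|.
Proof.
move=> z1b z2b z3b cvz1 v4 v2 z1p z2p.
pose Q1 := fixed_moved z1 z2; pose Q2 := fixed_moved z2 z3.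
pose Q3 := fixed_moved z3 z1.
have cardQ2 : #|Q2| = #|Q1| by rewrite -[RHS](card_fixed_movedJ b) z1b z2b.
have cardQ3 : #|Q3| = #|Q2| by rewrite -[RHS](card_fixed_movedJ b) z2b z3b.
have le4 : 4 <= #|Q1|.
  rewrite -v2 in z2p; rewrite -(semiregular4 v4 z2p).
  apply/subset_leq_card/subsetP=> _ /orbitP[_ /cycleP[k ->] <-] /=.
  have vkE z : commute v z -> (z ((v ^+ k) p) == (v ^+ k) p) = (z p == p).
    move=> cvz; rewrite -permM -(commuteX k (commute_sym cvz)) permM.
    by rewrite (inj_eq perm_inj).
  rewrite /aperm inE !vkE ?z1p -?v2 //.
  exact: commuteX.
have disj12 : [disjoint Q1 & Q2].
  rewrite -setI_eq0; apply/eqP/setP=> q; rewrite !inE.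
  by case: (z2 q == q); rewrite ?andbF.
have disj3 : [disjoint Q1 :|: Q2 & Q3].
  rewrite -setI_eq0; apply/eqP/setP=> q; rewrite !inE.
  by case: (z1 q == q); case: (z3 q == q); rewrite ?andbF ?andbT.
have := max_card (mem (Q1 :|: Q2 :|: Q3)).
move: disj12 disj3; rewrite -!leq_card_setU => /eqP c12 /eqP c3.
by rewrite c3 c12 cardQ3 cardQ2; lia.
Qed.

(** The hypotheses say that no involution of [<<[set u; v]>>] fixes [p].  If
    [u ^+ k * v ^+ l] fixes [p], so does its square [z1 ^+ k * z2 ^+ l], where
    [z1 = u ^+ 2] and [z2 = v ^+ 2]; hence [k] and [l] are even, and the element
    itself is [z1 ^+ k./2 * z2 ^+ l./2], so that 4 divides [k] and [l].  The 16
    images of [p] under these products are therefore distinct. *)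
Lemma free_bound (T : finType) (u v : {perm T}) (p : T) :
    commute u v -> u ^+ 4 = 1 -> v ^+ 4 = 1 ->
    (u ^+ 2) p != p -> (v ^+ 2) p != p -> (u ^+ 2 * v ^+ 2) p != p ->
  16 <= #|T|.
Proof.
move=> cuv u4 v4 z1p z2p z3p.
have z11 : u ^+ 2 * u ^+ 2 = 1 by rewrite -expgD.
have z22 : v ^+ 2 * v ^+ 2 = 1 by rewrite -expgD.
pose f (ij : 'I_4 * 'I_4) := (u ^+ ij.1 * v ^+ ij.2) p.
have evenP k l : (u ^+ 2 ^+ k * v ^+ 2 ^+ l) p = p -> ~~ odd k && ~~ odd l.
  have red z m : z * z = 1 -> z ^+ m = z ^+ odd m :> {perm T}.
    move=> zz; rewrite -{1}(odd_double_half m) expgD -mul2n expgM.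
    by rewrite [z ^+ 2]zz expg1n mulg1.
  rewrite (red _ k z11) (red _ l z22).
  case: (odd k); case: (odd l); rewrite ?expg1 ?expg0 ?mulg1 ?mul1g => // /eqP.
  - by rewrite (negPf z3p).
  - by rewrite (negPf z1p).
  - by rewrite (negPf z2p).
have dvd4 k l : (u ^+ k * v ^+ l) p = p -> (4 %| k) && (4 %| l).
  move=> fixp.
  have /evenP/andP[ek el] : (u ^+ 2 ^+ k * v ^+ 2 ^+ l) p = p.
    rewrite -!expgM ![(2 * _)%N]mulnC !expgM -expgMn; last exact: commuteX2.
    by rewrite expgS expg1 permM !fixp.
  have /evenP : (u ^+ 2 ^+ k./2 * v ^+ 2 ^+ l./2) p = p.
    by rewrite -!expgM !mul2n !even_halfK.
  by lia.
have uvD i j k l :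
    u ^+ (i + k) * v ^+ (j + l) = u ^+ i * v ^+ j * (u ^+ k * v ^+ l).
  rewrite !expgD -!mulgA; congr (_ * _); rewrite !mulgA; congr (_ * _).
  exact: commuteX2.
have f_inj : injective f.
  move=> [i j] [i' j']; rewrite /f /= => fE.
  (* [u ^+ (4 - i')] is the inverse of [u ^+ i'], with an exponent in [nat]. *)
  have /dvd4 : (u ^+ (i + (4 - i')) * v ^+ (j + (4 - j'))) p = p.
    rewrite uvD permM fE -permM -uvD !subnKC ?u4 ?v4 ?mulg1 ?perm1 //.
      exact/ltnW.
    exact/ltnW.
  have := ltn_ord i; have := ltn_ord i'; have := ltn_ord j; have := ltn_ord j'.
  by move=> *; congr (_, _); apply/val_inj => /=; lia.
by have := leq_card f f_inj; rewrite card_prod !card_ord.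
Qed.

(** The relations make [<<[set u; v]>>] a copy of [C_4 x C_4] on whose three
    involutions [b] acts as a 3-cycle. *)
Lemma perm_degree_ge12 (T : finType) (u b : {perm T}) (v := u ^ b) :
    commute u v -> v ^ b = (u * v)^-1 -> u ^+ 4 = 1 -> u ^+ 2 != 1 ->
  12 <= #|T|.
Proof.
move=> cuv vb u4 u2.
have v4 : v ^+ 4 = 1 by rewrite -conjXg u4 conj1g.
pose z1 := u ^+ 2; pose z2 := v ^+ 2; pose z3 := z1 * z2.
have z11 : z1 * z1 = 1 by rewrite -expgD.
have z22 : z2 * z2 = 1 by rewrite -expgD.
have cz12 : z1 * z2 = z2 * z1 by exact: commuteX2.
have z1b : z1 ^ b = z2 by rewrite conjXg.
have z2b : z2 ^ b = z3.
  rewrite conjXg vb expgVn expgMn //; apply/eqP.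
  by rewrite eq_invg_mul -/z1 -/z2 /z3 {1}cz12 -mulgA (mulgA z1) z11 mul1g z22.
have z3b : z3 ^ b = z1 by rewrite conjMg z1b z2b /z3 cz12 mulgA z22 mul1g.
have cvz1 : commute v z1 by apply: commuteX; exact: commute_sym.
have [p z1p] : exists p, z1 p != p.
  apply/existsP; apply: contraR u2; rewrite negb_exists => /forallP z1T.
  by apply/eqP/permP=> q; rewrite perm1; apply/eqP; rewrite -[_ == _]negbK z1T.
(* A point fixed by [z2] or [z3] is carried by [b^-1] or [b], respectively, to a
   point fixed by [z1] and moved by [z2]. *)
have bound := fixed_moved_bound z1b z2b z3b cvz1 v4 (erefl z2).
have [z2p | z2p] := eqVneq (z2 p) p.
  apply: (bound (b^-1 p)).
    by rewrite -(inj_eq (@perm_inj _ b)) -permJ z1b permKV z2p.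
  by rewrite -(inj_eq (@perm_inj _ b)) -permJ z2b permKV /z3 cz12 permM z2p.
have [z3p | z3p] := eqVneq (z3 p) p.
  apply: (bound (b p)); first by rewrite -z3b permJ z3p.
  by rewrite -z1b permJ (inj_eq perm_inj).
by apply: leq_trans (free_bound cuv u4 v4 z1p z2p z3p).
Qed.

Lemma embeds_degree_ge12 (gT : finGroupType) (X : {group gT}) (n : nat) (u b : gT)
    (v := u ^ b) :
    u \in X -> b \in X -> commute u v -> v ^ b = (u * v)^-1 ->
    u ^+ 4 = 1 -> u ^+ 2 != 1 ->
  embeds_in_Sym X n -> 12 <= n.
Proof.
move=> Xu Xb cuv vb u4 u2 /existsP[K /isogP[f injf _]].
have Xv : v \in X by rewrite groupJ.
rewrite -(card_ord n); apply: (@perm_degree_ge12 _ (f u) (f b)).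
- by rewrite -morphJ // /commute -!morphM // cuv.
- by rewrite -!morphJ // vb morphV ?(groupM Xu Xv) // (morphM f Xu Xv).
- by rewrite -morphX // u4 morph1.
- by rewrite -morphX // morph_injm_eq1 ?groupX.
Qed.

(** * The imprimitive action of a wreath product *)

Section WreathDegree.

Variables (gT : finGroupType) (n : nat).

(** An element [w] is the product of its permutation part [w.1] followed by its
    base part [w.2]: the block index is moved first, and the coordinate of [w.2]
    at the new index then acts by right translation. *)
Definition wr_move (ih : 'I_n * gT) (w : wreathSym gT n) : 'I_n * gT :=
  (w.1 ih.1, ih.2 * w.2 (w.1 ih.1)).

Lemma wr_move1 : wr_move^~ 1 =1 id.
Proof. by move=> [i h]; rewrite /wr_move /= perm1 oneg_ffun mulg1. Qed.

Lemma wr_moveM ih : act_morph wr_move ih.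
Proof.
case: ih => i h w w'; rewrite /wr_move /= permM; congr (_, _).
by rewrite mulg_ffun ffunE permK mulgA.
Qed.

Definition wr_action := TotalAction wr_move1 wr_moveM.

Lemma embeds_wreathSym : embeds_in_Sym [set: wreathSym gT n] (n * #|gT|).
Proof.
have -> : (n * #|gT|)%N = #|{: 'I_n * gT}| by rewrite card_prod card_ord.
apply: (@embeds_of_injm _ _ _ [morphism of actperm wr_action]).
apply/injmP=> w w' _ _ /permP eq_ww'.
have ww1 i : w.1 i = w'.1 i.
  by have := eq_ww' (i, 1); rewrite /= !actpermE => -[].
apply: val_inj; rewrite [LHS]surjective_pairing [RHS]surjective_pairing.
congr (_, _); first exact/permP.
apply/ffunP=> i; have := eq_ww' (w.1^-1 i, 1).
by rewrite /= !actpermE => -[_] /=; rewrite !mul1g -ww1 permKV.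
Qed.

End WreathDegree.

(** * The group G(m,p,n) inside the wreath product *)

Section WreathMpn.

Variables m p n : nat.

Let W : finGroupType := wreathSym (cyc m) n.
Let to := coord_groupAction (cyc m) n.

Definition wr_Gmpn : {group W} :=
  ((sdpair1 to @* A_mpn m p n) <*> (sdpair2 to @* [set: 'S_n]))%G.

(** The coordinate action preserves [A_mpn], so Sym(n) normalises its image. *)
Lemma wr_GmpnE :
  wr_Gmpn = (sdpair1 to @* A_mpn m p n) * (sdpair2 to @* [set: 'S_n]) :> {set W}.
Proof.
apply: norm_joinEr; rewrite -actsEsd ?subsetT //.
by case: (coord_acts_A m p n).
Qed.

(** The inclusions of [A_mpn] and Sym(n) into the wreath product glue to a
    morphism from their external semidirect product, injective because the base
    group meets Sym(n) trivially. *)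
Lemma wr_Gmpn_isog : wr_Gmpn \isog [set: G_mpn m p n].
Proof.
pose fA := restrm (subsetT (A_mpn m p n)) (sdpair1 to).
have fA_act : {in A_mpn m p n & [set: 'S_n],
    morph_act <[coord_acts_A m p n]>%gact 'J fA (sdpair2 to)}.
  move=> th s Ath _; rewrite /= actbyE ?in_setT //.
  by apply: sdpair_act; rewrite ?inE.
pose f := [morphism of xsdprodm fA_act].
rewrite isog_sym; apply/isogP; exists f.
  rewrite injm_xsdprodm injm_restrm ?injm_sdpair1 // injm_sdpair2.
  rewrite morphim_restrm setIid !andTb -subG1 -(im_sdpair_TI to).
  exact/setSI/morphimS/subsetT.
rewrite im_xsdprodm morphim_restrm setIid.
by rewrite wr_GmpnE.
Qed.

End WreathMpn.

(** * The decomposition of the wreath product of C_4 by Sym(3) *)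

Local Notation pt1 := (@Ordinal 3 0 isT).
Local Notation pt2 := (@Ordinal 3 1 isT).
Local Notation pt3 := (@Ordinal 3 2 isT).
Local Notation base := {dffun 'I_3 -> cyc 4}.
Local Notation base_act := (coord_groupAction (cyc 4) 3).

Lemma ord3P (P : 'I_3 -> Prop) : P pt1 -> P pt2 -> P pt3 -> forall i, P i.
Proof.
move=> P1 P2 P3 [[|[|[|//]]] lti].
- by rewrite (_ : Ordinal lti = pt1) //; apply: val_inj.
- by rewrite (_ : Ordinal lti = pt2) //; apply: val_inj.
- by rewrite (_ : Ordinal lti = pt3) //; apply: val_inj.
Qed.

Lemma baseC (th u : base) : th * u = u * th.
Proof. by apply/ffunP=> i; rewrite !mulg_ffun; exact: Zp_mulgC. Qed.

Lemma baseXE (th : base) k i : (th ^+ k) i = th i ^+ k.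
Proof.
by elim: k => [|k IH]; rewrite ?oneg_ffun // !expgS mulg_ffun IH.
Qed.

Lemma dfung1E (c : cyc 4) (i j : 'I_3) :
  dfung1 (gT := fun=> cyc 4) (i := i) c j = if i == j then c else 1.
Proof. by case: eqVneq => [<-|/dfung1_dflt ->]; first exact: dfung1_id. Qed.

Lemma prod3E (th : base) : \prod_(i < 3) th i = th pt1 * th pt2 * th pt3.
Proof.
rewrite !big_ord_recr big_ord0 /= mul1g.
congr (th _ * th _ * th _); exact: val_inj.
Qed.

Lemma mem_A443 (th : base) :
  (th \in A_mpn 4 4 3) = (th pt1 * th pt2 * th pt3 == 1).
Proof. by rewrite inE prod3E expg1. Qed.

Definition coordE := (mulg_ffun, invg_ffun, baseXE, dfung1E).

Lemma cyc4_expg4 (h : cyc 4) : h ^+ 4 = 1.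
Proof. by apply: val_inj; case: h => [[|[|[|[|//]]]]]. Qed.

(** The cube of [h] is its inverse. *)
Lemma cyc4_cube (h : cyc 4) : (h * h * h == 1) = (h == 1).
Proof. by case: h => [[|[|[|[|//]]]]]. Qed.

Section Generators.

Variable c : cyc 4.
Hypothesis cyc_c : generator [set: cyc 4] c.

Let W := wreathSym (cyc 4) 3.
Let g1 : W := wr_coord pt1 c.
Let g2 : W := wr_coord pt2 c.
Let g3 : W := wr_coord pt3 c.
Let a : W := wr_perm (cyc 4) (tperm pt2 pt3).
Let b : W := wr_perm (cyc 4) (perm (@ordS_inj 3)).
Let x := g1^-1 * g2 ^+ 2 * g3^-1.
Let y := g1^-1 * g2^-1 * g3 ^+ 2.
Let H := <[g1 * g2 * g3]>%G.
Let G := <<[set x; y; a; b]>>%G.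

Notation d i := (dfung1 (gT := fun=> cyc 4) (i := i) c).

Lemma cyc4_pow (h : cyc 4) : exists k, h = c ^+ k.
Proof.
by apply/cycleP; rewrite -(eqP cyc_c) inE.
Qed.

Lemma xE : x = sdpair1 base_act ((d pt1)^-1 * d pt2 ^+ 2 * (d pt3)^-1).
Proof. by rewrite !(morphM, morphV, morphX) ?in_setT. Qed.

Lemma yE : y = sdpair1 base_act ((d pt1)^-1 * (d pt2)^-1 * d pt3 ^+ 2).
Proof. by rewrite !(morphM, morphV, morphX) ?in_setT. Qed.

(** Over Z/4, the exponents of [x] and [y] in [g1 * g2^-1] and [g2 * g3^-1] form
    the matrix [[-1, 1], [-1, -2]] of determinant 3, a unit; the next two lemmas
    are its inverse. *)
Lemma u_xy : g1 * g2^-1 = y * x ^- 2.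
Proof.
rewrite xE yE -?morphX -?morphV -?morphM ?in_setT //; congr (sdpair1 _ _).
apply/ffunP; apply: ord3P; rewrite !coordE /=; apply: val_inj;
  by case: c => [[|[|[|[|//]]]]].
Qed.

Lemma v_xy : g2 * g3^-1 = y * x^-1.
Proof.
rewrite xE yE -?morphX -?morphV -?morphM ?in_setT //; congr (sdpair1 _ _).
apply/ffunP; apply: ord3P; rewrite !coordE /=; apply: val_inj;
  by case: c => [[|[|[|[|//]]]]].
Qed.

(** A vector [(c ^+ k, c ^+ l, _)] of product 1 has exponents
    [k (1, -1, 0) + (k + l) (0, 1, -1)]. *)
Lemma A_genE (th : base) : th \in A_mpn 4 4 3 ->
  exists k l, sdpair1 base_act th = (g1 * g2^-1) ^+ k * (g2 * g3^-1) ^+ l.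
Proof.
have [k Ek] := cyc4_pow (th pt1); have [l El] := cyc4_pow (th pt2).
rewrite mem_A443 => /eqP Eth; exists k, (k + l).
rewrite -?morphV -?morphM -?morphX -?morphM ?in_setT //; congr (sdpair1 _ _).
apply/ffunP; apply: ord3P; rewrite !coordE /=.
- by rewrite Ek !mulg1 expg1n mulg1.
- by rewrite El mul1g mulg1 expgD expgVn mulKg.
- by move/eqP: Eth; rewrite -eq_invg_mul => /eqP <-; rewrite Ek El !mul1g expg1n
    mul1g expgVn expgD.
Qed.

Lemma ordS_expg3 : perm (@ordS_inj 3) ^+ 3 = 1.
Proof. by apply/permP; apply: ord3P; rewrite !permM !permE; apply: val_inj. Qed.

(** The orders 2 and 3 of the generators are coprime, so their product 6 = 3!
    divides the order of the generated group. *)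
Lemma Sym3_gen : <<[set tperm pt2 pt3; perm (@ordS_inj 3)]>> = [set: 'S_3].
Proof.
set P := <<_>>; apply/eqP; rewrite eqEcard subsetT cardsT card_Sn /=.
apply: dvdn_leq; first exact: cardG_gt0.
have Ps : tperm pt2 pt3 \in P by rewrite mem_gen // !inE eqxx.
have Pr : perm (@ordS_inj 3) \in P by rewrite mem_gen // !inE eqxx orbT.
rewrite (@Gauss_dvd 2 3) //; apply/andP; split.
  have o2 : #[tperm pt2 pt3] = 2.
    apply: nt_prime_order => //; first exact: tperm2.
    by apply/eqP=> /permP/(_ pt2); rewrite tpermL perm1.
  by rewrite -[X in X %| _]o2 order_dvdG.
have o3 : #[perm (@ordS_inj 3)] = 3.
  apply: nt_prime_order => //; first exact: ordS_expg3.
  by apply/eqP=> /permP/(_ pt1); rewrite permE perm1.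
by rewrite -[X in X %| _]o3 order_dvdG.
Qed.

Lemma G_eq : G = wr_Gmpn 4 4 3.
Proof.
apply/val_inj/eqP; rewrite eqEsubset; apply/andP; split.
  rewrite gen_subG !subUset !sub1set /=.
  have Pin s : wr_perm (cyc 4) s \in wr_Gmpn 4 4 3.
    apply: (subsetP (joing_subr _ _)).
    by rewrite mem_morphim ?in_setT.
  have Ain (th : base) : th \in A_mpn 4 4 3 -> sdpair1 base_act th \in wr_Gmpn 4 4 3.
    by move=> Ath; apply: (subsetP (joing_subl _ _)); rewrite mem_morphim ?in_setT.
  rewrite !Pin !andbT xE yE !Ain // mem_A443 !coordE /=; apply/eqP/val_inj;
    by case: c => [[|[|[|[|//]]]]].
have [Gx Gy] : x \in G /\ y \in G by rewrite !mem_gen // !inE eqxx ?orbT.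
have [Ga Gb] : a \in G /\ b \in G by rewrite !mem_gen // !inE eqxx ?orbT.
rewrite join_subG; apply/andP; split.
  apply/subsetP=> _ /morphimP[th _ /A_genE[k [l th_kl]] ->].
  by rewrite /= th_kl groupM ?groupX // ?u_xy ?v_xy groupM ?groupV ?groupX.
rewrite sub_morphim_pre ?subsetT //.
have: <<[set tperm pt2 pt3; perm (@ordS_inj 3)]>> \subset sdpair2 base_act @*^-1 G.
  rewrite gen_subG; apply/subsetP=> s /set2P[] ->.
  - by rewrite mem_morphpre ?in_setT.
  - by rewrite mem_morphpre ?in_setT.
by rewrite Sym3_gen.
Qed.

Let gamma := g1 * g2 * g3.

Lemma gammaE : gamma = sdpair1 base_act [ffun=> c].
Proof.
rewrite /gamma -!morphM ?in_setT //; congr (sdpair1 _ _).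
by apply/ffunP; apply: ord3P; rewrite !coordE ffunE /= ?mul1g ?mulg1.
Qed.

Lemma gamma_central (w : W) : commute gamma w.
Proof.
rewrite (sdpairE w) gammaE; apply: commuteM; last first.
  by rewrite /commute -!morphM ?in_setT // baseC.
apply/commgP/conjg_fixP; rewrite -sdpair_act ?in_setT //.
by congr (sdpair1 _ _); apply/ffunP=> i; rewrite !ffunE.
Qed.

Lemma gammaX k : gamma ^+ k = sdpair1 base_act [ffun=> c ^+ k].
Proof.
rewrite gammaE -morphX ?in_setT //; congr (sdpair1 _ _).
by apply/ffunP=> i; rewrite baseXE !ffunE.
Qed.

Lemma gammaX_eq1 k : (gamma ^+ k == 1) = (c ^+ k == 1).
Proof.
rewrite gammaX morph_injm_eq1 ?injm_sdpair1 ?in_setT //.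
apply/eqP/eqP=> [/ffunP/(_ pt1) | ->]; first by rewrite !ffunE.
by apply/ffunP=> i; rewrite !ffunE.
Qed.

(** Trivial intersection: a constant vector [h] in [G] satisfies [h * h * h = 1],
    hence [h = 1].  Generation: scaling a vector of product [t] by [t] gives the
    product [t * (t * t * t) = 1]. *)
Lemma dprod_G_H : G \x H = [set: W].
Proof.
have cGH : H \subset 'C(G).
  apply/subsetP=> _ /cycleP[k ->]; rewrite groupX //.
  by apply/centP=> w _; apply: gamma_central.
have TI : G :&: H = 1.
  apply/trivgP/subsetP=> w /setIP[Gw /cycleP[k w_k]]; move: Gw; rewrite w_k.
  rewrite -/gamma gammaX G_eq wr_GmpnE.
  case/mulsgP=> _ _ /morphimP[th _ Ath ->] /morphimP[s _ _ ->] th_s.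
  have s1 : sdpair2 base_act s = 1.
    apply/set1P; rewrite -[[set 1]](im_sdpair_TI base_act) inE andbC mem_morphim ?in_setT //=.
    rewrite -(mulKg (sdpair1 base_act th) (sdpair2 base_act s)) -th_s -morphV ?in_setT //.
    by rewrite -morphM ?in_setT // mem_morphim ?in_setT.
  move: th_s; rewrite /= s1 mulg1 => /(injmP (injm_sdpair1 base_act)) th_c.
  rewrite inE -gammaX.
  move: Ath; rewrite -{}th_c ?in_setT // mem_A443 !ffunE.
  by rewrite cyc4_cube gammaX_eq1.
rewrite dprodE //; apply/eqP; rewrite -subTset; apply/subsetP=> w _.
have: w \in [set: W] by [].
rewrite -(im_sdpair base_act) => /mulsgP[_ _ /morphimP[th _ _ ->] /morphimP[s _ _ ->] ->].
have [m Em] := cyc4_pow (th pt1 * th pt2 * th pt3).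
pose r : base := [ffun=> c ^+ m].
have -> : sdpair1 base_act th * sdpair2 base_act s =
    sdpair1 base_act (th * r) * sdpair2 base_act s * gamma ^- m.
  rewrite morphM ?in_setT //= /r -gammaX -(mulgA (sdpair1 base_act th)).
  by rewrite -(commuteX m (commute_sym (gamma_central _))) mulgA mulgK.
apply: mem_mulg; last by rewrite groupV mem_cycle.
rewrite G_eq wr_GmpnE mem_mulg ?mem_morphim ?in_setT //.
rewrite inE prod_cycM !prod3E Em !ffunE expg1 -mulgA; apply/eqP.
exact: cyc4_expg4.
Qed.

Lemma c2_neq1 : c ^+ 2 != 1.
Proof. by rewrite -order_dvdn orderE -(eqP cyc_c) cardsT card_ord. Qed.

Lemma card_H : #|H| = 4.
Proof.
apply: order_eq4; last by rewrite gammaX_eq1 c2_neq1.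
by apply/eqP; rewrite gammaX_eq1 cyc4_expg4.
Qed.

(** Here [q pt1 pt2], [q pt2 pt3] and [q pt3 pt1] are [u], [v] and [v ^ b]. *)
Lemma embeds_G_ge12 (n : nat) : embeds_in_Sym G n -> 12 <= n.
Proof.
pose q (i j : 'I_3) : W := wr_coord i c * (wr_coord j c)^-1.
have qE i j : q i j = sdpair1 base_act (d i * (d j)^-1).
  by rewrite morphM ?in_setT // morphV ?in_setT.
have qJ i j : q i j ^ b = q (ordS i) (ordS j).
  by rewrite conjMg conjVg !wr_coordJ !permE.
have q12 : q pt1 pt2 ^ b = q pt2 pt3 by rewrite qJ; congr q; apply: val_inj.
have q23 : q pt2 pt3 ^ b = q pt3 pt1 by rewrite qJ; congr q; apply: val_inj.
have [Gx Gy] : x \in G /\ y \in G by rewrite !mem_gen // !inE eqxx ?orbT.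
apply: (@embeds_degree_ge12 _ _ _ (q pt1 pt2) b).
- by rewrite /q u_xy groupM ?groupV ?groupX.
- by rewrite mem_gen // !inE eqxx ?orbT.
- by rewrite q12 !qE /commute -!morphM ?in_setT // baseC.
- rewrite q12 q23 !qE -morphM ?in_setT // -morphV ?in_setT //; congr (sdpair1 _ _).
  by apply/ffunP; apply: ord3P; rewrite !coordE /=; apply: val_inj;
    case: c => [[|[|[|[|//]]]]].
- rewrite qE -morphX ?in_setT // -(morph1 (sdpair1_morphism base_act)); congr (sdpair1 _ _).
  by apply/ffunP=> i; rewrite baseXE cyc4_expg4 oneg_ffun.
- rewrite qE -morphX ?in_setT // morph_injm_eq1 ?injm_sdpair1 ?in_setT //.
  apply: contra c2_neq1 => /eqP/ffunP/(_ pt1).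
  by rewrite !coordE /= oneg_ffun invg1 mulg1 => c2; apply/eqP.
Qed.

Lemma embeds_W12 : embeds_in_Sym [set: W] 12.
Proof. by have := embeds_wreathSym (cyc 4) 3; rewrite card_ord. Qed.

(** The lower bound passes from [G] to [W], which contains it. *)
Lemma mu_GxH : mu (setX_group G H) = 12.
Proof.
have isoW : setX_group G H \isog [set: W].
  by apply: isog_dprod (setX_dprod G H) dprod_G_H _ _; rewrite isog_sym;
    [exact: isog_setX1 | exact: isog_set1X].
rewrite (mu_isog isoW); apply/eqP; rewrite eqn_leq mu_min ?embeds_W12 //=.
by apply: embeds_G_ge12; apply: embeds_subset (mu_embeds _); exact: subsetT.
Qed.

Lemma mu_G : mu G = 12.
Proof.
apply/eqP; rewrite eqn_leq embeds_G_ge12 ?mu_embeds // andbT; apply: mu_min.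
exact: (embeds_subset (subsetT G) embeds_W12).
Qed.

Lemma mu_H : mu H = 4.
Proof. by apply: mu_cyclic4 card_H; exact: cycle_cyclic. Qed.

Lemma mu_GxH_lt : mu (setX_group G H) < mu G + mu H.
Proof. by rewrite mu_GxH mu_G mu_H. Qed.

Lemma mu_G_plus_H : mu G + mu H = 16.
Proof. by rewrite mu_G mu_H. Qed.

Lemma isog_G : G \isog [set: G_mpn 4 4 3].
Proof. by rewrite G_eq; exact: wr_Gmpn_isog. Qed.

End Generators.

(* Coordinates 1, 2, 3 are indexed by 0, 1, 2; ordS is i |-> i + 1 mod 3, so b
   is the 3-cycle (1 2 3). *)
Theorem mainTheorem1 :
  (forall c : cyc 4, generator [set: cyc 4] c ->
    let i1 : 'I_3 := @Ordinal 3 0 isT in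
    let i2 : 'I_3 := @Ordinal 3 1 isT in
    let i3 : 'I_3 := @Ordinal 3 2 isT in
    let W := [set: wreathSym (cyc 4) 3] in
    let g1 : wreathSym (cyc 4) 3 := wr_coord i1 c in
    let g2 : wreathSym (cyc 4) 3 := wr_coord i2 c in
    let g3 : wreathSym (cyc 4) 3 := wr_coord i3 c in
    let a : wreathSym (cyc 4) 3 := wr_perm (cyc 4) (tperm i2 i3) in
    let b : wreathSym (cyc 4) 3 := wr_perm (cyc 4) (perm (@ordS_inj 3)) in
    let x := g1^-1 * g2 ^+ 2 * g3^-1 in
    let y := g1^-1 * g2^-1 * g3 ^+ 2 in
    let H := <[g1 * g2 * g3]>%G in
    let G := <<[set x; y; a; b]>>%G in
    [/\ G \isog [set: G_mpn 4 4 3],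
        G \x H = W,
        12 = mu (setX_group G H),
        mu (setX_group G H) < mu G + mu H
      & mu G + mu H = 16])
  /\ ~ (forall (gT1 gT2 : finGroupType) (H : {group gT1}) (K : {group gT2}),
          mu (setX_group H K) = mu H + mu K)
  /\ (exists (gT1 gT2 : finGroupType) (H : {group gT1}) (K : {group gT2}),
        mu (setX_group H K) = 12 /\ mu (setX_group H K) <> mu H + mu K).
Proof.
have main (c : cyc 4) (cyc_c : generator [set: cyc 4] c) :=
  And5 (isog_G cyc_c) (dprod_G_H cyc_c) (esym (mu_GxH cyc_c))
    (mu_GxH_lt cyc_c) (mu_G_plus_H cyc_c).
have cyc_1 : generator [set: cyc 4] (Zp1 : cyc 4) by apply/eqP; exact: Zp_cycle.
split; first exact: main.
have [_ _ GH12 lt16 _] := main _ cyc_1.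
split=> [mu_add | ]; first by rewrite mu_add ltnn in lt16.
eexists _, _, _, _; split; first exact: (esym GH12).
by move=> mu_add; rewrite mu_add ltnn in lt16.
Qed.
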